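(* Let $\Gamma$ be a distance-regular graph with vertex set $X$ and diameter $D\ge 3$ that is $Q$-polynomial with respect to the ordering $E_0,E_1,\ldots,E_D$ of its primitive idempotents. Fix a vertex $x\in X$, and let $\tilde V^{\mu\nu}_{i,j}$ ($\mu,\nu\in\{\downarrow,\uparrow\}$, $0\le i,j\le D$) be the components of the four split decompositions of the standard module $V=\mathbb{C}^X$ with respect to $x$. Then the following (i), (ii) hold for all integers $i,j,r,s$ with $0\le i,j,r,s\le D$, where orthogonality is with respect to the standard Hermitian form on $V$. (i) $\tilde V^{\downarrow\downarrow}_{i,j}$ and $\tilde V^{\uparrow\uparrow}_{r,s}$ are orthogonal unless $i+r=D$ and $j+s=D$. (ii) $\tilde V^{\downarrow\uparrow}_{i,j}$ and $\tilde V^{\uparrow\downarrow}_{r,s}$ are orthogonal unless $i+r=D$ and $j+s=D$.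
   Context: Distance-regular graphs. $\Gamma$ is a finite, undirected, connected graph without loops or multiple edges, with vertex set $X$, path-length distance $\partial$ and diameter $D=\max\{\partial(y,z): y,z\in X\}$. It is distance-regular if for all $0\le h,i,j\le D$ and all $y,z\in X$ with $\partial(y,z)=h$, the number $|\{w\in X:\partial(y,w)=i,\ \partial(w,z)=j\}|$ depends only on $h,i,j$. For $0\le i\le D$ the distance matrix $A_i\in\mathrm{Mat}_X(\mathbb{C})$ has $(y,z)$ entry $1$ if $\partial(y,z)=i$ and $0$ otherwise. The Bose-Mesner algebra $M$ is the span of $A_0,\ldots,A_D$; it is a commutative subalgebra of $\mathrm{Mat}_X(\mathbb{C})$, generated by $A=A_1$. It has a basis $E_0,\ldots,E_D$ of primitive idempotents: real symmetric matrices with $E_0=|X|^{-1}J$ ($J$ the all-ones matrix), $\sum_i E_i=I$, $E_iE_j=\delta_{ij}E_i$. $Q$-polynomial property. The Krein parameters $q^h_{ij}$ are defined by $E_i\circ E_j=|X|^{-1}\sum_{h=0}^D q^h_{ij}E_h$, where $\circ$ is the entrywise product. $\Gamma$ is $Q$-polynomial with respect to the ordering $E_0,\ldots,E_D$ if for all $0\le h,i,j\le D$: $q^h_{ij}=0$ whenever one of $h,i,j$ is greater than the sum of the other two, and $q^h_{ij}\ne 0$ whenever one of $h,i,j$ equals the sum of the other two. Standard module. $V=\mathbb{C}^X$ (column vectors indexed by $X$), on which $\mathrm{Mat}_X(\mathbb{C})$ acts by left multiplication, with the standard Hermitian form $\langle u,v\rangle=u^t\overline{v}$. Dual idempotents.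 For the fixed vertex $x$ and $0\le i\le D$, $E^*_i=E^*_i(x)$ is the diagonal matrix in $\mathrm{Mat}_X(\mathbb{C})$ with $(y,y)$ entry $1$ if $\partial(x,y)=i$ and $0$ otherwise. Split decompositions of $V$. For $-1\le i,j\le D$ define $V^{\downarrow\downarrow}_{i,j}=(E^*_0V+\cdots+E^*_iV)\cap(E_0V+\cdots+E_jV)$, $V^{\uparrow\downarrow}_{i,j}=(E^*_DV+\cdots+E^*_{D-i}V)\cap(E_0V+\cdots+E_jV)$, $V^{\downarrow\uparrow}_{i,j}=(E^*_0V+\cdots+E^*_iV)\cap(E_DV+\cdots+E_{D-j}V)$, $V^{\uparrow\uparrow}_{i,j}=(E^*_DV+\cdots+E^*_{D-i}V)\cap(E_DV+\cdots+E_{D-j}V)$, each interpreted as $0$ if $i=-1$ or $j=-1$. For $\mu,\nu\in\{\downarrow,\uparrow\}$ and $0\le i,j\le D$, $\tilde V^{\mu\nu}_{i,j}$ is the orthogonal complement (with respect to $\langle\,,\,\rangle$) of $V^{\mu\nu}_{i-1,j}+V^{\mu\nu}_{i,j-1}$ in $V^{\mu\nu}_{i,j}$. It is known that $V=\sum_{i=0}^D\sum_{j=0}^D\tilde V^{\mu\nu}_{i,j}$ is a direct sum, called the $(\mu,\nu)$-split decomposition of $V$ with respect to $x$. *)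

(* Defs.v *)
From HB Require Import structures.
From mathcomp Require Import all_boot all_order all_algebra.

Set Implicit Arguments.
Unset Strict Implicit.
Unset Printing Implicit Defensive.

Import GRing.Theory Num.Theory.

Local Open Scope ring_scope.

Section Graph.
Variables (X : finType) (e : rel X).

Definition connected_simple_graph : Prop :=
  [/\ symmetric e, irreflexive e & forall y z, connect e y z].

(* Least length of a walk from y to z. In a connected graph this length is
   smaller than #|X|; if z is not reachable from y the value is #|X|. *)
Definition dist (y z : X) : nat :=
  find (fun n => [exists p : n.-tuple X, path e y p && (last y p == z)])
       (iota 0 #|X|).

Definition diameter : nat := (\max_(y : X) \max_(z : X) dist y z)%N.

Definition distance_regular : Prop :=
  forall h i j : 'I_diameter.+1, exists p : nat,
    forall y z : X, dist y z = h ->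
      #|[set w : X | (dist y w == i) && (dist w z == j)]| = p.

End Graph.

(* Vectors and matrices indexed by X use the index type 'I_#|X|; the index a
   stands for the vertex enum_val a. *)

Section HermitianForm.
Variables (C : numClosedFieldType) (n : nat).

Definition hform (u v : 'cV[C]_n) : C := (u^T *m map_mx Num.conj v) 0 0.

Lemma hformE u v : hform u v = \sum_k u k 0 * (v k 0)^*.
Proof. by rewrite /hform mxE; apply: eq_bigr => k _; rewrite !mxE. Qed.

Fact hform_bilinear :
  bilinear_for (GRing.Scale.Law.clone _ _ ( *%R : C -> C -> C) _)
    (GRing.Scale.Law.clone _ _ (Num.conj \; *%R : C -> C -> C) _) hform.
Proof.
split=> w a u v; rewrite !hformE /= mulr_sumr -big_split; apply: eq_bigr => k _.
  by rewrite !mxE mulrDl mulrA.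
by rewrite !mxE rmorphD rmorphM mulrDr mulrCA.
Qed.

Fact hform_hermitian u v : hform u v = (-1) ^+ false * (hform v u)^*.
Proof.
rewrite expr0 mul1r !hformE rmorph_sum; apply: eq_bigr => k _.
by rewrite rmorphM /= conjCK mulrC.
Qed.

HB.instance Definition _ := bilinear_isBilinear.Build C _ _ _
  (GRing.Scale.Law.clone _ _ ( *%R : C -> C -> C) _)
  (GRing.Scale.Law.clone _ _ (Num.conj \; *%R : C -> C -> C) _)
  hform hform_bilinear.

HB.instance Definition _ :=
  @isHermitianSesquilinear.Build C _ false Num.conj hform hform_hermitian.

End HermitianForm.

Section BoseMesner.
Variables (C : numClosedFieldType) (X : finType) (e : rel X).

Local Notation D := (diameter e).
Local Notation Mat := 'M[C]_#|X|.

Definition distance_mx (i : nat) : Mat :=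
  \matrix_(a, b) (dist e (enum_val a) (enum_val b) == i)%:R.

Definition bose_mesner : {vspace Mat} :=
  <<[seq distance_mx i | i : 'I_D.+1]>>%VS.

Definition primitive_idempotents (E : 'I_D.+1 -> Mat) : Prop :=
  [/\ basis_of bose_mesner [seq E i | i : 'I_D.+1],
      E ord0 = #|X|%:R^-1 *: const_mx 1,
      \sum_i E i = 1%:M,
      forall i j, E i *m E j = if i == j then E i else 0
    & forall i, map_mx Num.conj (E i) = E i /\ (E i)^T = E i].

(* q h i j is the Krein parameter $q^h_{ij}$. It is determined by this
   condition as soon as E is linearly independent. *)
Definition krein_parameters (E : 'I_D.+1 -> Mat)
    (q : 'I_D.+1 -> 'I_D.+1 -> 'I_D.+1 -> C) : Prop :=
  forall i j, map2_mx *%R (E i) (E j) =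
    #|X|%:R^-1 *: \sum_h q h i j *: E h.

Definition Q_polynomial (E : 'I_D.+1 -> Mat) : Prop :=
  exists2 q, krein_parameters E q &
    forall h i j : 'I_D.+1,
      ([|| i + j < h, h + j < i | h + i < j]%N -> q h i j = 0) /\
      ([|| h == i + j :> nat, i == h + j :> nat | j == h + i :> nat]%N ->
        q h i j != 0).

End BoseMesner.

Inductive arrow := Down | Up.

Section SplitDecomposition.
Variables (C : numClosedFieldType) (X : finType) (e : rel X).
Variables (E : 'I_(diameter e).+1 -> 'M[C]_#|X|) (x : X).

Local Notation D := (diameter e).
Local Notation V := 'cV[C]_#|X|.

Definition dual_idempotent (i : nat) : 'M[C]_#|X| :=
  diag_mx (\row_a (dist e x (enum_val a) == i)%:R).

Definition image_mx (A : 'M[C]_#|X|) : {vspace V} := limg (linfun (mulmx A)).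

(* k is one of 0, ..., i (Down), respectively one of D - i, ..., D (Up).
   For i = -1 there is no such k <= D. *)
Definition in_range (m : arrow) (i : int) (k : 'I_D.+1) : bool :=
  match m with
  | Down => k%:Z <= i
  | Up => D%:Z - i <= k%:Z
  end.

(* The integers i and j range over -1, ..., D; if one of them is -1 then the
   corresponding sum is empty and the intersection is 0. *)
Definition split_space (mu nu : arrow) (i j : int) : {vspace V} :=
  ((\sum_(k < D.+1 | in_range mu i k) image_mx (dual_idempotent k)) :&:
   (\sum_(k < D.+1 | in_range nu j k) image_mx (E k)))%VS.

Definition split_component (mu nu : arrow) (i j : 'I_D.+1) : {vspace V} :=
  (split_space mu nu i j :&:
   orthov (@hform C #|X|)
     (split_space mu nu (i%:Z - 1) j + split_space mu nu i (j%:Z - 1)))%VS.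

End SplitDecomposition.

(* Main.v *)
(** For natural numbers m let F m be the sum of the E*_k V with k < m, and G m
    the sum of the E_k V with k < m.  The adjacency matrix A maps F m into
    F (m+1) and acts on G (m+1) as a scalar modulo G m, and the dual adjacency
    matrix A* behaves in the same way with F and G exchanged.  Hence the sum
    S_c of the F k n G (c-k), k = 0, ..., c, is stable under A and A*, so under
    all E_k and E*_k, because A and A* have D+1 distinct eigenvalues.  Thus the
    orthogonal projection onto S_c preserves every F m and every G m.

    Let u be in the (i,j) component of the split decomposition given by F and
    G, and v in the (r,s) component of the one given by the reversed orderings;
    put a = D-r and b = D-s.  If i < a or j < b then u is orthogonal to v
    since v is orthogonal to F a + G b.  Otherwise, unless (i,j) = (a,b), we
    have i+j > a+b; take c = a+b+2.  As v lies in (F (a+1) n G (b+1)) + F a +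
    G b and is orthogonal to F a + G b, it belongs to S_c.  As S_c is contained
    in F i + G j, the projection of u to S_c is a sum of elements of
    F i n G (j+1) and F (i+1) n G j, both orthogonal to u; so it is zero. *)

From HB Require Import structures.
Require Import Defs.
From mathcomp Require Import all_boot all_order all_algebra.
From mathcomp Require Import reals complex.
From mathcomp Require Import zify ring.

Local Open Scope ring_scope.

Set Implicit Arguments.
Unset Strict Implicit.
Unset Printing Implicit Defensive.

Import Order.TTheory GRing.Theory Num.Theory.

(** * Orthogonality for the Hermitian form *)

Section Form.
Variables (C : numClosedFieldType) (n : nat).
Implicit Types (u v w : 'cV[C]_n) (U : {vspace 'cV[C]_n}) (M : 'M[C]_n).

Fact hform_dot u : u != 0 -> 0 < hform u u.
Proof.
have ge0 k : 0 <= u k 0 * (u k 0)^* by rewrite -normCK exprn_ge0.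
move=> u_neq0; rewrite hformE lt_def sumr_ge0 // andbT.
apply: contra u_neq0; rewrite psumr_eq0 // => /allP u0.
apply/eqP/matrixP => k j; rewrite ord1 mxE.
by move: (u0 k (mem_index_enum _)); rewrite /= mul_conjC_eq0 => /eqP.
Qed.

HB.instance Definition _ :=
  isDotProduct.Build C 'cV[C]_n (@hform C n) hform_dot.

Lemma hform0l u : hform 0 u = 0. Proof. exact: linear0l. Qed.

Lemma hform0r u : hform u 0 = 0. Proof. exact: linear0r. Qed.

Lemma hformDl u v w : hform (u + v) w = hform u w + hform v w.
Proof. exact: linearDl. Qed.

Lemma hformDr u v w : hform u (v + w) = hform u v + hform u w.
Proof. exact: linearDr. Qed.

Lemma hform_eq0C u v : hform u v = 0 -> hform v u = 0.
Proof. by move/eqP; rewrite herm_eq0C => /eqP. Qed.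

Lemma hform_eq0 u : hform u u = 0 -> u = 0.
Proof. by move/eqP; rewrite dnorm_eq0 => /eqP. Qed.

Lemma orthov_hformP U v : reflect (forall w, w \in U -> hform v w = 0)
  (v \in orthov (@hform C n) U).
Proof. exact: mem_orthovP. Qed.

Lemma ortho_split U v :
  exists p q : 'cV[C]_n, [/\ v = p + q, p \in U & q \in orthov (@hform C n) U].
Proof.
have [p] := orthogonal_split (@hform C n) (vbasis U) v.
rewrite (span_basis (vbasisP U)) => pU [q [-> _ /orthoPl qU]].
exists p, q; split=> //; apply/orthov_hformP => w wU.
rewrite [w](coord_vbasis wU) linear_sumr big1 //= => k _.
by rewrite linearZr_LR /= qU ?mulr0 // mem_nth // size_tuple.
Qed.

Lemma orthovK_sub U v : (forall w, w \in orthov (@hform C n) U -> hform v w = 0) ->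
  v \in U.
Proof.
move=> vU; have [p [q [def_v pU qU]]] := ortho_split U v.
have: hform q q = 0.
  have := vU q qU; rewrite def_v hformDl => <-.
  by rewrite (hform_eq0C (orthov_hformP _ _ qU p pU)) add0r.
by move/hform_eq0 => q0; rewrite def_v q0 addr0.
Qed.

Definition hermitian_mx M := map_mx Num.conj M = M^T.

Lemma hform_adj M u v : hermitian_mx M -> hform (M *m u) v = hform u (M *m v).
Proof. by rewrite /hform map_mxM trmx_mul => ->; rewrite mulmxA. Qed.

Definition stable_under M U := forall u, u \in U -> M *m u \in U.

Lemma stable_underC M U : hermitian_mx M -> stable_under M U ->
  stable_under M (orthov (@hform C n) U).
Proof.
move=> hM sM q /orthov_hformP qU; apply/orthov_hformP => w wU.
by rewrite hform_adj // qU // sM.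
Qed.

End Form.

(** * Filtrations attached to orthogonal idempotents *)

Section Resolution.
Variables (C : numClosedFieldType) (n D : nat).
Implicit Types (K : 'I_D.+1 -> 'M[C]_n) (u v w : 'cV[C]_n).

Definition resolution K :=
  [/\ forall h k, K h *m K k = if h == k then K h else 0,
      \sum_k K k = 1%:M & forall k, hermitian_mx (K k)].

Definition isum K (P : pred 'I_D.+1) : {vspace 'cV[C]_n} :=
  (\sum_(k < D.+1 | P k) limg (linfun (mulmx (K k))))%VS.

Lemma sum_resolution K u : resolution K -> \sum_k K k *m u = u.
Proof. by case=> _ K1 _; rewrite -mulmx_suml K1 mul1mx. Qed.

Lemma isumP K P u : resolution K ->
  reflect (forall k, ~~ P k -> K k *m u = 0) (u \in isum K P).
Proof.
move=> rK; apply: (iffP idP) => [/memv_sumP[w wK ->] k Pk|u0].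
  rewrite mulmx_sumr big1 // => h Ph; have /memv_imgP[z _ ->] := wK h Ph.
  have [KK _ _] := rK; rewrite lfunE /= mulmxA KK.
  by case: eqP Ph Pk => [->->|_]; rewrite ?mul0mx.
rewrite -(sum_resolution u rK) (bigID P) /= [X in _ + X]big1 // addr0.
apply: memv_sumr => k Pk; apply/memv_imgP.
by exists u; rewrite ?memvf // lfunE.
Qed.

(** Both [U] and its orthogonal complement are stable under [K k], so [K k *m p] and [K k *m q] are
    orthogonal; where they cancel, both vanish. *)
Lemma isum_split K P U p q : resolution K ->
    (forall k, stable_under (K k) U) ->
    p \in U -> q \in orthov (@hform C n) U -> p + q \in isum K P ->
  p \in isum K P /\ q \in isum K P.
Proof.
move=> rK sU pU qU pqP; have [_ _ hK] := rK.
have Kpq0 k : ~~ P k -> K k *m p + K k *m q = 0.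
  by move=> Pk; rewrite -mulmxDr; apply: (isumP _ _ rK pqP).
have Kp0 k : ~~ P k -> K k *m p = 0.
  move=> Pk; apply: hform_eq0; have := hform0l (K k *m p).
  rewrite -(Kpq0 k Pk) hformDl.
  rewrite (orthov_hformP _ _ (stable_underC (hK k) (sU k) qU)) ?sU //.
  by rewrite addr0.
split; apply/isumP => // k Pk.
by rewrite -[RHS](Kpq0 k Pk) Kp0 // add0r.
Qed.

Lemma isum_orthov K P v : resolution K ->
  (v \in orthov (@hform C n) (isum K P)) = (v \in isum K (predC P)).
Proof.
move=> rK; have [KK _ hK] := rK; apply/orthov_hformP/isumP => // v0 k.
  rewrite negbK => Pk; apply: hform_eq0.
  rewrite hform_adj // v0 //; apply/isumP => // h Ph; rewrite !mulmxA !KK.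
  by case: eqP Ph => [->|_ _]; rewrite ?Pk ?mul0mx.
move/isumP => k0; rewrite -(sum_resolution v rK) linear_sumlz big1 //= => h _.
have [Ph|Ph] := boolP (P h); first by rewrite v0 ?hform0l //= negbK.
by rewrite hform_adj // k0 ?hform0r.
Qed.

(** Product of the operators [A - theta l] applied to [u], built factor by factor so that stability
    of a subspace passes through by induction. *)
Definition shift_prod (A : 'M[C]_n) (theta : 'I_D.+1 -> C) u (s : seq 'I_D.+1) :=
  foldr (fun l w => A *m w - theta l *: w) u s.

Lemma mul_shift_prod K theta u s m : resolution K ->
  K m *m shift_prod (\sum_k theta k *: K k) theta u s =
  (\prod_(l <- s) (theta m - theta l)) *: (K m *m u).
Proof.
move=> rK; have [KK _ _] := rK; elim: s => [|l s IH] /=.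
  by rewrite big_nil scale1r.
rewrite mulmxBr mulmxA mulmx_sumr (bigD1 m) //= [X in (_ + X) *m _]big1 => [|k].
  rewrite addr0 -!scalemxAr KK eqxx -scalemxAl IH !scalerA -scalerBl -mulrBl.
  by rewrite big_cons.
by rewrite eq_sym -scalemxAr KK => /negPf ->; rewrite scaler0.
Qed.

(** Lagrange interpolation: the factors kill every eigencomponent except that of [k]. *)
Lemma shift_prod_all_but K theta k u : resolution K ->
  shift_prod (\sum_k theta k *: K k) theta u (rem k (enum 'I_D.+1)) =
  (\prod_(l | l != k) (theta k - theta l)) *: (K k *m u).
Proof.
move=> rK; set w := shift_prod _ _ _ _.
have prodE m : \prod_(l <- rem k (enum 'I_D.+1)) (theta m - theta l) =
    \prod_(l | l != k) (theta m - theta l).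
  rewrite (rem_filter _ (enum_uniq _)) big_filter big_enum_cond /=.
  by [].
rewrite -(sum_resolution w rK) (bigD1 k) //= [X in _ + X]big1 => [|m mk].
  by rewrite addr0 mul_shift_prod // prodE.
by rewrite mul_shift_prod // prodE (bigD1 m) //= subrr mul0r scale0r.
Qed.

(** By interpolation a polynomial in the operator sends [u] to a multiple of [K k *m u], nonzero as
    a scalar because the eigenvalues are distinct. *)
Lemma stable_resolution K theta U : resolution K -> injective theta ->
  stable_under (\sum_k theta k *: K k) U -> forall k, stable_under (K k) U.
Proof.
move=> rK inj_th sU k u uU.
have sw s : shift_prod (\sum_k theta k *: K k) theta u s \in U.
  by elim: s => //= l s IH; rewrite memvB ?memvZ ?sU.
have := sw (rem k (enum 'I_D.+1)); rewrite shift_prod_all_but // rpredZeq.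
case/predU1P=> // /eqP; rewrite prodf_seq_eq0 => /hasP[l _ /andP[lk]].
by rewrite subr_eq0 => /eqP/inj_th kl; rewrite kl eqxx in lk.
Qed.

(* The bound is strict: the sum of the first i + 1 eigenspaces, written with
   index i in the paper, is [filt K i.+1], and index -1 is [filt K 0]. *)
Definition filt K (m : nat) := isum K (fun k => (k < m)%N).

Lemma filtP K m u : resolution K ->
  reflect (forall k : 'I_D.+1, (m <= k)%N -> K k *m u = 0) (u \in filt K m).
Proof.
by move=> rK; apply: (iffP (isumP _ _ rK)) => u0 k mk; apply: u0; lia.
Qed.

Lemma filt0 K u : resolution K -> u \in filt K 0 -> u = 0.
Proof.
move=> rK /filtP u0; rewrite -(sum_resolution u rK) big1 // => k _.
exact: u0.
Qed.

Lemma filt_sub K m m' : resolution K -> (m <= m')%N -> (filt K m <= filt K m')%VS.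
Proof.
move=> rK mm'; apply/subvP => u /filtP u0; apply/filtP => // k m'k.
by apply: u0 => //; apply: leq_trans m'k.
Qed.

Definition tridiagonal (A : 'M[C]_n) K :=
  forall h k : 'I_D.+1, (h.+1 < k)%N || (k.+1 < h)%N -> K h *m A *m K k = 0.

Lemma tridiagonal_filt A K m u : resolution K -> tridiagonal A K ->
  u \in filt K m -> A *m u \in filt K m.+1.
Proof.
move=> rK tA /filtP u0; apply/filtP => // h mh.
rewrite -(sum_resolution u rK) !mulmx_sumr big1 // => k _.
have [mk|km] := leqP m k; first by rewrite u0 // !mulmx0.
by rewrite !mulmxA tA ?mul0mx //; apply/orP; right; lia.
Qed.

Lemma shift_filt K theta m : resolution K ->
  exists t, forall u, u \in filt K m.+1 ->
    (\sum_k theta k *: K k) *m u - t *: u \in filt K m.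
Proof.
move=> rK; have [Dm|mD] := ltnP D m.
  (* For [m] beyond [D], [filt K m] is the whole space and any scalar serves. *)
  exists 0 => u _; apply/filtP => // k mk.
  by have := ltn_ord k; lia.
(* The only eigenspace in [filt K m.+1] beyond [filt K m] has index [m]; shifting by its eigenvalue
   kills it. *)
exists (theta (inord m)) => u /filtP u0; apply/filtP => // k mk.
rewrite (mul_shift_prod theta u [:: inord m] k rK) big_seq1.
move: mk; rewrite leq_eqVlt => /predU1P[def_m|mk]; last by rewrite u0 ?scaler0.
suff ->: k = inord m by rewrite subrr scale0r.
by apply: val_inj; rewrite /= inordK.
Qed.

(** * Antidiagonal sums of two filtrations (the spaces S_c) *)

Definition diag K L (c : nat) : {vspace 'cV[C]_n} :=
  (\sum_(k < c.+1) (filt K k :&: filt L (c - k)))%VS.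

Lemma diagC K L c : diag K L c = diag L K c.
Proof.
rewrite /diag (reindex_inj rev_ord_inj); apply: eq_bigr => k _ /=.
by rewrite capvC subSS subKn // -ltnS.
Qed.

Lemma diag_sup K L a b u : u \in filt K a -> u \in filt L b ->
  u \in diag K L (a + b).
Proof.
move=> uK uL; have ab : (a < (a + b).+1)%N by lia.
apply: (subvP (sumv_sup (Ordinal ab) _ (subvv _))) => //.
by rewrite memv_cap uK /= addKn.
Qed.

Lemma diag_le K L c i j : resolution K -> resolution L -> (c <= (i + j).+1)%N ->
  (diag K L c <= filt K i + filt L j)%VS.
Proof.
move=> rK rL cij; apply/subv_sumP => k _; have [ki|ik] := leqP k i.
  exact: subv_trans (capvSl _ _) (subv_trans (filt_sub rK ki) (addvSl _ _)).
apply: subv_trans (capvSr _ _) (subv_trans (filt_sub rL _) (addvSr _ _)).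
by lia.
Qed.

(** On [filt K k :&: filt L b.+1], subtracting the scalar [t] lowers the [L]-bound by one while
    tridiagonality raises the [K]-bound by one, so the bounds still add up to [c]. *)
Lemma diag_stable K L theta c : resolution K -> resolution L ->
    tridiagonal (\sum_k theta k *: L k) K ->
  stable_under (\sum_k theta k *: L k) (diag K L c).
Proof.
set A := \sum_k _ => rK rL tA u /memv_sumP[w wP ->].
rewrite mulmx_sumr memv_suml // => k _; have := wP k isT.
rewrite memv_cap => /andP[wK]; case def_b: (c - k)%N => [|b] wL.
  by rewrite (filt0 rL wL) mulmx0 mem0v.
have def_c : c = (k.+1 + b)%N by lia.
have [t wt] := shift_filt theta b rL.
have wS : w k \in diag K L c.
  have -> : c = (k + b.+1)%N by lia.
  exact: diag_sup.
rewrite -[A *m w k](subrK (t *: w k)) memvD ?memvZ // {wS}.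
rewrite def_c diag_sup ?wt // memvB ?tridiagonal_filt // memvZ //.
exact: (subvP (filt_sub rK (leqnSn k))).
Qed.

End Resolution.

(** * Duality of split decompositions *)

Section Duality.
Variables (C : numClosedFieldType) (n D : nat).
Implicit Types (K L : 'I_D.+1 -> 'M[C]_n) (u v w : 'cV[C]_n).

Definition split_comp K L (i j : nat) : {vspace 'cV[C]_n} :=
  (filt K i.+1 :&: filt L j.+1 :&: orthov (@hform C n)
     (filt K i :&: filt L j.+1 + filt K i.+1 :&: filt L j))%VS.

Lemma split_compP K L i j u : u \in split_comp K L i j ->
  [/\ u \in filt K i.+1, u \in filt L j.+1,
      forall w, w \in filt K i -> w \in filt L j.+1 -> hform u w = 0
    & forall w, w \in filt K i.+1 -> w \in filt L j -> hform u w = 0].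
Proof.
rewrite !memv_cap => /andP[/andP[uK uL] /orthov_hformP uo].
split=> // w wK wL; apply: uo.
  by rewrite -[w]addr0 memv_add ?mem0v // memv_cap wK.
by rewrite -[w]add0r memv_add ?mem0v // memv_cap wK.
Qed.

(** Reversal exchanges the down and up filtrations, so [split_comp] covers all four
    decompositions. *)
Definition rev_idem K (k : 'I_D.+1) := K (rev_ord k).

Lemma rev_idemK K : rev_idem (rev_idem K) =1 K.
Proof. by move=> k; rewrite /rev_idem rev_ordK. Qed.

Lemma eq_split_comp K K' L L' i j :
  K =1 K' -> L =1 L' -> split_comp K L i j = split_comp K' L' i j.
Proof.
move=> eqK eqL.
have eqF (M M' : 'I_D.+1 -> 'M[C]_n) m : M =1 M' -> filt M m = filt M' m.
  by move=> eqM; apply: eq_bigr => k _; rewrite eqM.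
by rewrite /split_comp !(eqF _ _ _ eqK) !(eqF _ _ _ eqL).
Qed.

Lemma rev_resolution K : resolution K -> resolution (rev_idem K).
Proof.
case=> KK K1 hK; split=> [h k||k]; rewrite /rev_idem ?hK //.
  by rewrite KK (inj_eq rev_ord_inj).
by rewrite -K1 [RHS](reindex_inj rev_ord_inj).
Qed.

(** Distinct eigenspaces are orthogonal and together span, so the complement of the first [D.+1 - m]
    is the sum of the last [m]. *)
Lemma filt_rev K m v : resolution K ->
  (v \in filt (rev_idem K) m) = (v \in orthov (@hform C n) (filt K (D.+1 - m))).
Proof.
move=> rK; rewrite isum_orthov //.
apply/(isumP _ _ (rev_resolution rK))/(isumP _ _ rK) => v0 k /= mk.
  rewrite -[k]rev_ordK; apply: v0 => /=; lia.
by apply: v0; rewrite /=; have := ltn_ord k; lia.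
Qed.

Lemma orthov_add U W v : v \in orthov (@hform C n) (U + W) ->
  v \in orthov (@hform C n) U /\ v \in orthov (@hform C n) W.
Proof.
move/orthov_hformP=> vUW; split; apply/orthov_hformP => w wU; apply: vUW.
  by rewrite -[w]addr0 memv_add ?mem0v.
by rewrite -[w]add0r memv_add ?mem0v.
Qed.

Variables (K L : 'I_D.+1 -> 'M[C]_n) (theta phi : 'I_D.+1 -> C).
Hypotheses (rK : resolution K) (rL : resolution L).
Hypotheses (inj_theta : injective theta) (inj_phi : injective phi).
Hypothesis triK : tridiagonal (\sum_k theta k *: L k) K.
Hypothesis triL : tridiagonal (\sum_k phi k *: K k) L.

Lemma diag_stableL c k : stable_under (L k) (diag K L c).
Proof. exact: stable_resolution rL inj_theta (diag_stable rK rL triK) _. Qed.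

Lemma diag_stableK c k : stable_under (K k) (diag K L c).
Proof.
rewrite diagC.
exact: stable_resolution rK inj_phi (diag_stable rL rK triL) _.
Qed.

Lemma split_comp_orthov_diag i j c u : u \in split_comp K L i j ->
  (c <= (i + j).+1)%N -> u \in orthov (@hform C n) (diag K L c).
Proof.
case/split_compP=> uK uL uoK uoL cij.
have [p [q [def_u pS qS]]] := ortho_split (diag K L c) u.
rewrite def_u in uK uL.
have [pK _] := isum_split rK (@diag_stableK c) pS qS uK.
have [pL _] := isum_split rL (@diag_stableL c) pS qS uL.
have /memv_addP[f fK [g gL def_p]] := subvP (diag_le rK rL cij) _ pS.
(* Being [p - g], the vector [f] of [filt K i] also lies in [filt L j.+1], hence is orthogonal to
   [u]; symmetrically for [g]. *)
have fL : f \in filt L j.+1.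
  have -> : f = p - g by rewrite def_p addrK.
  by rewrite memvB //; apply: (subvP (filt_sub rL (leqnSn j))).
have gK : g \in filt K i.+1.
  have -> : g = p - f by rewrite def_p addrC addKr.
  by rewrite memvB //; apply: (subvP (filt_sub rK (leqnSn i))).
suff p0 : p = 0 by rewrite def_u p0 add0r.
apply: hform_eq0; rewrite -[LHS]addr0.
rewrite -[X in _ + X](orthov_hformP _ _ qS p pS) -hformDl -def_u.
by rewrite def_p hformDr uoK // uoL // addr0.
Qed.

Lemma split_comp_rev_diag r s v :
    v \in split_comp (rev_idem K) (rev_idem L) r s -> (r <= D)%N -> (s <= D)%N ->
  v \in diag K L ((D - r).+1 + (D - s).+1).
Proof.
case/split_compP=> vK vL voK voL rD sD; set a := (D - r)%N; set b := (D - s)%N.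
have voF : forall w, w \in filt K a -> hform v w = 0.
  by apply/orthov_hformP; move: vK; rewrite filt_rev.
have voG : forall w, w \in filt L b -> hform v w = 0.
  by apply/orthov_hformP; move: vL; rewrite filt_rev.
(* A vector orthogonal to an intersection of reversed filtrations lies in the sum of their
   complements. The two decompositions so obtained give [f - f' = g' - g], in both [filt K a.+1] and
   [filt L b.+1]. *)
have /memv_addP[f fK [g gL def_v]] : v \in (filt K a.+1 + filt L b)%VS.
  apply: orthovK_sub => w /orthov_add[wK wL]; apply: voK; rewrite filt_rev //.
  by rewrite subSn.
have /memv_addP[f' fK' [g' gL' def_v']] : v \in (filt K a + filt L b.+1)%VS.
  apply: orthovK_sub => w /orthov_add[wK wL]; apply: voL; rewrite filt_rev //.
  by rewrite subSn.
set c := (a.+1 + b.+1)%N.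
have ffS : f - f' \in diag K L c.
  apply: diag_sup.
    by rewrite memvB //; apply: (subvP (filt_sub rK (leqnSn a))).
  have -> : f - f' = g' - g.
    by apply/eqP; rewrite subr_eq addrAC -subr_eq opprK -def_v addrC -def_v'.
  by rewrite memvB //; apply: (subvP (filt_sub rL (leqnSn b))).
(* In [v = (f - f') + f' + g] only [f'] and [g] may leave the diagonal sum; their remainders [f2],
   [g2] orthogonal to it stay in [filt K a] and [filt L b]. *)
have [f1 [f2 [def_f f1S f2S]]] := ortho_split (diag K L c) f'.
have [g1 [g2 [def_g g1S g2S]]] := ortho_split (diag K L c) g.
have [_ f2K] : f1 \in filt K a /\ f2 \in filt K a.
  by apply: (isum_split rK (@diag_stableK c) f1S f2S); rewrite -def_f.
have [_ g2L] : g1 \in filt L b /\ g2 \in filt L b.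
  by apply: (isum_split rL (@diag_stableL c) g1S g2S); rewrite -def_g.
have vS : v - (f2 + g2) \in diag K L c.
  suff -> : v - (f2 + g2) = (f - f') + f1 + g1 
    by apply: memvD => //; apply: memvD.
  rewrite def_v def_f [in LHS]def_g [f2 + _]addrC addrA opprD addrA addrK.
  by rewrite [f1 + _]addrC opprD addrA addrNK addrAC.
(* As [v - (f2 + g2)] is orthogonal to [f2 + g2], the squared norm of the latter equals
   [hform v (f2 + g2)], which is zero. *)
have h0 : f2 + g2 = 0.
  apply: hform_eq0; rewrite -[LHS]add0r.
  have fg2S : f2 + g2 \in orthov (@hform C n) (diag K L c) by rewrite memvD.
  rewrite -[X in X + _](hform_eq0C (orthov_hformP _ _ fg2S _ vS)) -hformDl subrK.
  by rewrite hformDr voF ?voG ?addr0.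
by rewrite h0 subr0 in vS.
Qed.

Theorem split_comp_ortho i j r s u v :
    u \in split_comp K L i j ->
    v \in split_comp (rev_idem K) (rev_idem L) r s ->
    (r <= D)%N -> (s <= D)%N -> ~ ((i + r)%N = D /\ (j + s)%N = D) ->
  hform u v = 0.
Proof.
move=> uij vrs rD sD neq.
have [uK uL _ _] := split_compP uij; have [vK vL _ _] := split_compP vrs.
have [ir|ir] := ltnP (i + r) D.
  apply: hform_eq0C; move: vK; rewrite filt_rev // => /orthov_hformP; apply.
  by apply: (subvP (filt_sub rK _)) uK; lia.
have [js|js] := ltnP (j + s) D.
  apply: hform_eq0C; move: vL; rewrite filt_rev // => /orthov_hformP; apply.
  by apply: (subvP (filt_sub rL _)) uL; lia.
(* Here [i + r >= D] and [j + s >= D], not both equalities, so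
   [(D - r).+1 + (D - s).+1 <= (i + j).+1]. *)
have := split_comp_rev_diag vrs rD sD.
by apply/orthov_hformP/(split_comp_orthov_diag uij); lia.
Qed.

End Duality.

(** * Distance-regular graphs *)

Section Graph.
Variables (C : numClosedFieldType) (X : finType) (e : rel X) (x : X).
Variable E : 'I_(diameter e).+1 -> 'M[C]_#|X|.

Local Notation D := (diameter e).

(** * Split components as intersections of filtrations *)

Definition oriented n (m : arrow) (K : 'I_D.+1 -> 'M[C]_n) :=
  if m is Up then rev_idem K else K.

Lemma filt_oriented mu (K : 'I_D.+1 -> 'M[C]_#|X|) (m : nat) :
  (\sum_(k < D.+1 | in_range mu (m%:Z - 1) k) image_mx (K k))%VS =
  filt (oriented mu K) m.
Proof.
case: mu; first by apply: eq_bigl => k /=; lia.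
rewrite (reindex_inj rev_ord_inj); apply: eq_bigl => k /=.
by have := ltn_ord k; lia.
Qed.

Lemma split_componentE mu nu i j : split_component E x mu nu i j =
  split_comp (oriented mu (fun k => dual_idempotent C e x k)) (oriented nu E) i j.
Proof.
rewrite /split_component /split_space.
have eqS (k : 'I_D.+1) : k%:Z = k.+1%:Z - 1 by lia.
by rewrite !filt_oriented (eqS i) (eqS j) !filt_oriented.
Qed.

(** * Path-length distance *)

Lemma dist_min y z p : path e y p -> last y p = z -> (dist e y z <= size p)%N.
Proof.
move=> yp pz; rewrite leqNgt; apply/negP => lt_p.
have lt_pX : (size p < #|X|)%N.
  by apply: leq_trans lt_p _; rewrite -[leqRHS](size_iota 0) find_size.
have /existsP[] := negbT (before_find 0%N lt_p).
by rewrite nth_iota //; exists (in_tuple p); rewrite yp pz eqxx.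
Qed.

Hypothesis sgraph : connected_simple_graph e.

Lemma dist_path y z :
  exists2 p, path e y p & last y p = z /\ size p = dist e y z.
Proof.
have [_ _ /(_ y z)/connectP[p0 yp0 def_z]] := sgraph.
(* A repetition-free walk has fewer than [#|X|] edges, so the search in [dist] succeeds instead of
   returning its default. *)
case: (shortenP yp0) def_z => p yp Up _ def_z {p0 yp0}.
pose a := fun n => [exists p : n.-tuple X, path e y p && (last y p == z)].
have ltpX : (size p < #|X|)%N by have := max_card (mem (y :: p)); rewrite (card_uniqP Up).
have has_a : has a (iota 0 #|X|).
  apply/hasP; exists (size p); first by rewrite mem_iota.
  by apply/existsP; exists (in_tuple p); rewrite yp def_z eqxx.
have := nth_find 0%N has_a; rewrite nth_iota; last by rewrite -[ltnRHS](size_iota 0) -has_find.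
by case/existsP=> q /andP[yq /eqP qz]; exists q => //; rewrite size_tuple.
Qed.

Lemma dist_max y z : (dist e y z <= D)%N.
Proof.
apply: leq_trans (leq_bigmax (F := fun y => \max_z dist e y z) y).
exact: (leq_bigmax (F := fun z => dist e y z)).
Qed.

Lemma distxx y : dist e y y = 0%N.
Proof. by apply/eqP; rewrite -leqn0 (@dist_min y y [::]). Qed.

Lemma dist_edge y z w : e z w -> (dist e y w <= (dist e y z).+1)%N.
Proof.
move=> zw; have [p yp [pz <-]] := dist_path y z.
by rewrite -(size_rcons p w) dist_min ?last_rcons // rcons_path yp pz.
Qed.

Lemma dist_pred y z m : dist e y z = m.+1 -> exists2 w, e w z & dist e y w = m.
Proof.
move=> dyz; have [p] := dist_path y z; rewrite dyz.
case/lastP: p => [_ []//|p w]; rewrite rcons_path last_rcons size_rcons.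
case/andP=> yp pw [def_z [sz_p]]; rewrite def_z in pw.
exists (last y p) => //; apply/eqP; rewrite eqn_leq -{1}sz_p dist_min //=.
by rewrite -ltnS -dyz dist_edge.
Qed.

Lemma dist1 y z : (dist e y z == 1%N) = e y z.
Proof.
apply/eqP/idP => [/dist_pred[w wz] dyw|yz].
  have [p _ [pw sz_p]] := dist_path y w.
  by rewrite dyw in sz_p; rewrite (size0nil sz_p) /= in pw; rewrite pw.
apply/eqP; rewrite eqn_leq (@dist_min y z [:: z]) /= ?yz // lt0n.
apply/eqP => d0; have [_ irr _] := sgraph; have [p _ [pz sz_p]] := dist_path y z.
rewrite d0 in sz_p; rewrite (size0nil sz_p) /= in pz.
by rewrite -pz irr in yz.
Qed.

Definition dist_ord y z : 'I_D.+1 := Ordinal (dist_max y z : (dist e y z < D.+1)%N).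

Local Notation Estar := (fun k : 'I_D.+1 => dual_idempotent C e x k).
Local Notation A := (distance_mx C e 1).

(** * Dual idempotents and the adjacency matrix *)

Lemma dual_entry k a b : dual_idempotent C e x k a b =
  ((a == b) && (dist e x (enum_val a) == k))%:R.
Proof. by rewrite !mxE -mulnb natrM mulr_natl; case: (a == b). Qed.

Lemma resolution_dual : resolution Estar.
Proof.
split=> [h k||k].
- apply/matrixP => a b; rewrite mul_diag_mx mxE dual_entry mxE -natrM mulnb.
  have [<-|hk] := eqVneq h k; first by rewrite dual_entry andbCA andbb.
  by case: eqP => [->|_]; rewrite !mxE // val_eqE (negPf hk) andbF.
- apply/matrixP => a b; rewrite summxE mxE (bigD1 (dist_ord x (enum_val a))) //=.
  rewrite dual_entry eqxx andbT big1 ?addr0 // => k.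
  rewrite dual_entry -val_eqE /= eq_sym => /negPf ->.
  by rewrite andbF.
- apply/matrixP => a b; rewrite [LHS]mxE [RHS]mxE !dual_entry rmorph_nat eq_sym.
  by case: eqP => [->|].
Qed.

Lemma sum_dual (phi : 'I_D.+1 -> C) : \sum_k phi k *: Estar k =
  diag_mx (\row_a phi (dist_ord x (enum_val a))).
Proof.
apply/matrixP => a b; rewrite summxE (bigD1 (dist_ord x (enum_val a))) //=.
rewrite big1 => [|k].
  by rewrite mxE dual_entry eqxx andbT !mxE addr0 mulr_natr.
rewrite mxE dual_entry -val_eqE /= eq_sym => /negPf ->.
by rewrite andbF mulr0.
Qed.

(** Distances from [x] to two adjacent vertices differ by at most one. *)
Lemma tridiagonal_adjacency : tridiagonal A Estar.
Proof.
move=> h k hk; rewrite mul_diag_mx mul_mx_diag.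
apply/matrixP => a b; rewrite !mxE dist1.
case: eqP => [dh|]; last by rewrite !mul0r.
case: (boolP (e _ _)) => [ab|]; last by rewrite mulr0 mul0r.
case: eqP => [dk|]; last by rewrite mulr0.
have [sym _ _] := sgraph; have := dist_edge x ab.
rewrite sym in ab; have := dist_edge x ab; rewrite dh dk.
by move: hk; lia.
Qed.

(* A product of m shifts of A has the same entries as A ^ m at distance m and
   beyond; the entries at distance m count geodesics. *)
Lemma shift_prod_delta (theta : 'I_D.+1 -> C) a s b :
  let w := shift_prod A theta (delta_mx a 0) s in
  let d := dist e (enum_val a) (enum_val b) in
  ((size s < d)%N -> w b 0 = 0) /\ (d = size s -> 0 < w b 0).
Proof.
elim: s b => [|l s IH] b /=.
  rewrite !mxE eqxx andbT; split.
    by case: eqP => // ->; rewrite distxx.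
  case: eqP => // ab d0; have [p _ [pz sz_p]] := dist_path (enum_val a) (enum_val b).
  by rewrite d0 in sz_p; rewrite (size0nil sz_p) /= in pz; case: ab; apply: enum_val_inj.
set w := shift_prod _ _ _ _ in IH *.
have [sym _ _] := sgraph.
split=> [sd|ds]; rewrite !mxE.
  rewrite (proj1 (IH b)) ?mulr0 ?subr0; last exact: ltnW.
  rewrite big1 // => c _; rewrite mxE dist1.
  case: (boolP (e _ _)) => [bc|];
    last by rewrite mul0r.
  rewrite (proj1 (IH c)) ?mulr0 // -ltnS; apply: leq_trans sd _.
  by apply: dist_edge; rewrite sym.
rewrite (proj1 (IH b)) ?mulr0 ?subr0; last by rewrite ds.
have [z zb dz] := dist_pred ds.
rewrite (bigD1 (enum_rank z)) //= ltr_wpDr //.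
  rewrite sumr_ge0 // => c _; rewrite mxE dist1.
  case: (boolP (e _ _)) => [bc|];
    last by rewrite mul0r.
  have : (size s <= dist e (enum_val a) (enum_val c))%N.
    by rewrite -ltnS -ds dist_edge // sym.
  rewrite mul1r leq_eqVlt => /predU1P[sc|sc]; last by rewrite (proj1 (IH c)).
  exact/ltW/(proj2 (IH c)).
rewrite mxE dist1 enum_rankK sym zb mul1r.
by apply: (proj2 (IH _)); rewrite enum_rankK.
Qed.

Lemma diameter_attained : exists y z, dist e y z = D.
Proof.
have X0 : (0 < #|X|)%N by apply/card_gt0P; exists x.
have [y Dy] := bigop.eq_bigmax (fun y => (\max_z dist e y z)%N) X0.
have [z Dz] := bigop.eq_bigmax (fun z => dist e y z) X0.
by exists y, z; rewrite /diameter Dy Dz.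
Qed.

(** Were [theta k = theta l], the product of the [D] shifts with index other than [k] would be zero;
    yet its entry at two vertices at distance [D] is positive. *)
Lemma eigenvalue_inj (theta : 'I_D.+1 -> C) : resolution E ->
  A = \sum_k theta k *: E k -> injective theta.
Proof.
move=> rE defA k l kl; apply/eqP/contraT => neq_kl.
have [y [z dyz]] := diameter_attained.
have := shift_prod_all_but theta k (delta_mx (enum_rank y) 0) rE.
rewrite -defA (bigD1 l) /=; last by rewrite eq_sym.
rewrite kl subrr mul0r scale0r => /matrixP/(_ (enum_rank z) 0).
have [_] := shift_prod_delta theta (enum_rank y) (rem k (enum 'I_D.+1)) (enum_rank z).
rewrite !enum_rankK size_rem ?mem_enum // -cardE card_ord => /(_ dyz) w_gt0 w0.
by rewrite w0 mxE ltxx in w_gt0.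
Qed.


Lemma span_coord (f : 'I_D.+1 -> 'M[C]_#|X|) M :
  M \in <<[seq f i | i : 'I_D.+1]>>%VS -> exists c, M = \sum_i c i *: f i.
Proof.
rewrite span_def big_map big_enum => /memv_sumP[w wP ->].
have /fin_all_exists[c cP] i : exists ci, w i = ci *: f i by apply/vlineP/wP.
by exists c; apply: eq_bigr.
Qed.

Lemma trace_adj_eq0 (N : 'M[C]_#|X|) : \tr (N *m (map_mx Num.conj N)^T) = 0 -> N = 0.
Proof.
rewrite /mxtrace => /eqP; have ge0 a b : 0 <= N a b * (N a b)^*.
  by rewrite -normCK exprn_ge0.
have rowE a : (N *m (map_mx Num.conj N)^T) a a = \sum_b N a b * (N a b)^*.
  by rewrite mxE; apply: eq_bigr => b _; rewrite !mxE.
under eq_bigr do rewrite rowE.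
rewrite psumr_eq0 => [/allP N0|a _]; last by rewrite sumr_ge0.
apply/matrixP => a b; move: (N0 a (mem_index_enum _)).
rewrite /= psumr_eq0 // => /allP/(_ b (mem_index_enum _)) /=.
by rewrite mul_conjC_eq0 mxE => /eqP.
Qed.

(** * The dual adjacency matrix and the Q-polynomial property *)

Hypothesis prim : primitive_idempotents E.
Hypothesis Qpoly : Q_polynomial E.
Hypothesis D_gt0 : (0 < D)%N.

Lemma resolution_prim : resolution E.
Proof.
have [_ _ E1 EE hE] := prim; split=> // k.
by have [cE tE] := hE k; rewrite /hermitian_mx cE tE.
Qed.

Lemma adjacency_coord : exists theta, A = \sum_k theta k *: E k.
Proof.
have [/andP[/eqP spanE _] _ _ _ _] := prim; apply: span_coord; rewrite spanE.
by apply/memv_span/imageP; exists (inord 1); rewrite //= inordK.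
Qed.

Let o1 : 'I_D.+1 := inord 1.

(** [E o1] is a combination of distance matrices. The [phi k] are the dual eigenvalues divided by
    [#|X|], so [\sum_k phi k *: Estar k] is A* scaled by the same factor. *)
Lemma dual_coord : exists phi : 'I_D.+1 -> C,
  forall y z, E o1 (enum_rank y) (enum_rank z) = phi (dist_ord y z).
Proof.
have [/andP[/eqP spanE _] _ _ _ _] := prim.
have: E o1 \in bose_mesner C e by rewrite -spanE memv_span //; apply/imageP; exists o1.
case/span_coord => phi ->; exists phi => y z.
rewrite summxE (bigD1 (dist_ord y z)) //= big1 => [|k].
  by rewrite !mxE !enum_rankK eqxx mulr1 addr0.
by rewrite !mxE !enum_rankK -val_eqE /= eq_sym => /negPf ->; rewrite mulr0.
Qed.

(* The squared norm of [E h *m B *m E k] is the (x, x) entry of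
   [E 1 *m (E h o E k) *m E 1], which is a multiple of the Krein parameter
   [q 1 h k]. *)
Lemma tridiagonal_dual (phi : 'I_D.+1 -> C) :
    (forall y z, E o1 (enum_rank y) (enum_rank z) = phi (dist_ord y z)) ->
  tridiagonal (\sum_k phi k *: Estar k) E.
Proof.
move=> phiE h k hk; rewrite sum_dual; set B := diag_mx _.
have [_ _ _ EE hE] := prim; have [q qE q0] := Qpoly.
have symE i a b : E i a b = E i b a.
  by have [_ tE] := hE i; rewrite -[in LHS]tE mxE.
have BE a : B a a = E o1 (enum_rank x) a.
  by rewrite mxE eqxx mxE -phiE enum_valK.
have hB : (map_mx Num.conj B)^T = B.
  apply/matrixP => a b; rewrite 2!mxE; case: (eqVneq a b) => [->|ab].
    have [cE _] := hE o1; rewrite BE -[in RHS]cE mxE //.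
  by rewrite !mxE eq_sym (negPf ab) mulr0n rmorph0.
apply: trace_adj_eq0; rewrite !map_mxM !trmx_mul hB.
have adjE i : (map_mx Num.conj (E i))^T = E i by have [-> ->] := hE i.
rewrite !adjE -!mulmxA [E k *m (E k *m _)]mulmxA EE eqxx mxtrace_mulC.
rewrite -!mulmxA EE eqxx.
have o1E : o1 = 1%N :> nat by rewrite inordK.
have q1 : q o1 h k = 0.
  by apply: (proj1 (q0 o1 h k)); rewrite o1E; move: hk; lia.
have : (E o1 *m map2_mx *%R (E h) (E k) *m E o1) (enum_rank x) (enum_rank x) = 0.
  rewrite qE -scalemxAr mulmx_sumr -scalemxAl mulmx_suml big1 ?scaler0 ?mxE // => l _.
  rewrite -scalemxAr -scalemxAl EE; case: eqP => [<-|_]; last by rewrite mul0mx scaler0.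
  by rewrite q1 scale0r.
move=> <-; rewrite /mxtrace.
rewrite [RHS]mxE; under [RHS]eq_bigr do rewrite mxE mulr_suml.
rewrite exchange_big /=; apply: eq_bigr => a _.
rewrite mulmxA mxE; apply: eq_bigr => b _.
rewrite !mul_diag_mx !mxE -!phiE !enum_valK (symE h b) (symE o1 b); ring.
Qed.

(* Entrywise analogue of [shift_prod_delta]: for the entrywise product, m shifts
   of E_1 multiply to a combination of E_0, ..., E_m in which E_m occurs. *)
Lemma hadamard_prod (phi : 'I_D.+1 -> C) (s : seq 'I_D.+1) :
  exists c : 'I_D.+1 -> C,
  [/\ forall a b, \prod_(l <- s) (E o1 a b - phi l) = \sum_m c m * E m a b,
      forall m : 'I_D.+1, (size s < m)%N -> c m = 0
    & forall m : 'I_D.+1, m = size s :> nat -> c m != 0].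
Proof.
have [q qE q0] := Qpoly; have [_ E0 _ _ _] := prim.
have X0 : #|X|%:R != 0 :> C by rewrite pnatr_eq0 -lt0n; apply/card_gt0P; exists x.
have o1E : o1 = 1%N :> nat by rewrite inordK.
elim: s => [|l s [c [cE c_gt c_eq]]].
  (* The empty product is the all-ones matrix, that is [#|X|%:R *: E ord0]. *)
  exists (fun m => if m == ord0 then #|X|%:R else 0); split=> [a b|m|m] /=.
  - rewrite big_nil (bigD1 ord0) //= big1 => [|m /negPf ->]; last by rewrite mul0r.
    by rewrite E0 !mxE mulr1 divff ?addr0.
  - by rewrite -val_eqE /=; case: (val m).
  - by rewrite -val_eqE /= => ->.
exists (fun m => #|X|%:R^-1 * (\sum_h c h * q m o1 h) - phi l * c m); split.
- move=> a b; rewrite big_cons cE mulrBl.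
  under [RHS]eq_bigr do rewrite mulrBl -!mulrA.
  rewrite sumrB -!mulr_sumr; congr (_ - _).
  transitivity (\sum_h c h * (E o1 a b * E h a b)).
    by rewrite mulr_sumr; apply: eq_bigr => h _; ring.
  transitivity (\sum_h c h * (#|X|%:R^-1 * \sum_m q m o1 h * E m a b)).
    apply: eq_bigr => h _; congr (_ * _).
    have /matrixP/(_ a b) := qE o1 h; rewrite !mxE => ->.
    by rewrite summxE; congr (_ * _); apply: eq_bigr => m _; rewrite mxE.
  under eq_bigr do rewrite mulrCA mulr_sumr.
  rewrite -mulr_sumr exchange_big /=; congr (_ * _); apply: eq_bigr => m _.
  by rewrite mulr_suml; apply: eq_bigr => h _; rewrite mulrA.
- move=> m /= sm; rewrite c_gt ?mulr0 ?subr0; last exact: ltnW.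
  rewrite big1 ?mulr0 // => h _; have [sh|hs] := ltnP (size s) h.
    by rewrite c_gt ?mul0r.
  by rewrite (proj1 (q0 m o1 h)) ?mulr0 // o1E; lia.
- move=> m /= ms; rewrite (c_gt m) ?ms // mulr0 subr0.
  have sD : (size s < D.+1)%N by have := ltn_ord m; lia.
  (* Only [h = size s] contributes: [c h] vanishes for larger [h], and [q m o1 h] for smaller ones
     since then [m > 1 + h]. *)
  rewrite (bigD1 (Ordinal sD)) //= big1 => [|h hs].
    rewrite addr0 !mulf_neq0 ?invr_eq0 ?c_eq //.
    by apply: (proj2 (q0 _ _ _)); rewrite o1E ms /= add1n eqxx.
  have [sh|] := ltnP (size s) h; first by rewrite c_gt ?mul0r.
  rewrite leq_eqVlt => /predU1P[hs'|hs']; first by case/eqP: hs; apply: val_inj.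
  by rewrite (proj1 (q0 m o1 h)) ?mulr0 // o1E ms; lia.
Qed.

(** Were [phi k = phi l], the entrywise product of the shifts with index other than [k] would
    vanish: at distance [k] through the factor [l], at another distance [d] through the factor [d].
    But [E ord_max] occurs in it with nonzero coefficient. *)
Lemma dual_eigenvalue_inj (phi : 'I_D.+1 -> C) :
    (forall y z, E o1 (enum_rank y) (enum_rank z) = phi (dist_ord y z)) ->
  injective phi.
Proof.
move=> phiE k l kl; apply/eqP/contraT => neq_kl.
have [/andP[_ /free_not0 Efree] _ _ EE _] := prim.
have [c [cE _ c_eq]] := hadamard_prod phi (rem k (enum 'I_D.+1)).
have cD : c ord_max != 0.
  by apply: c_eq; rewrite size_rem ?mem_enum // -cardE card_ord.
have: c ord_max *: E ord_max = 0.
  have: \sum_m c m *: E m = 0.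
    apply/matrixP => a b; rewrite summxE mxE; under eq_bigr do rewrite mxE.
    rewrite -cE -[a]enum_valK -[b]enum_valK phiE.
    set d := dist_ord _ _; apply/eqP; rewrite prodf_seq_eq0.
    apply/hasP; exists (if d == k then l else d).
      rewrite mem_rem_uniq ?enum_uniq // inE mem_enum andbT.
      by case: (eqVneq d k) => //; rewrite eq_sym.
    by case: (d =P k) => [->|_]; rewrite /= ?kl subrr.
  move/(congr1 (mulmx (E ord_max))); rewrite mulmx0 mulmx_sumr.
  rewrite (bigD1 ord_max) //= big1 => [|m].
    by rewrite addr0 -scalemxAr EE eqxx.
  by rewrite eq_sym -scalemxAr EE => /negPf ->; rewrite scaler0.
move/eqP; rewrite scaler_eq0 (negPf cD) /= => E_D0.
have := Efree (E ord_max); rewrite E_D0.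
by apply; apply/imageP; exists ord_max.
Qed.

Lemma split_components_ortho nu (i j r s : 'I_D.+1) (u v : 'cV[C]_#|X|) :
    ~ ((i + r)%N = D /\ (j + s)%N = D) ->
    u \in split_component E x Down nu i j ->
    v \in split_component E x Up (if nu is Up then Down else Up) r s ->
  hform u v = 0.
Proof.
have rE := resolution_prim; have [theta defA] := adjacency_coord.
have [phi phiE] := dual_coord.
have triK : tridiagonal (\sum_k theta k *: E k) Estar.
  by rewrite -defA; apply: tridiagonal_adjacency.
have inj_th := eigenvalue_inj rE defA.
have triL := tridiagonal_dual phiE; have inj_phi := dual_eigenvalue_inj phiE.
have [rD sD] : (r <= D)%N /\ (s <= D)%N by split; rewrite -ltnS.
rewrite !split_componentE => neq; case: nu => /= uij vrs.
  exact: (split_comp_ortho resolution_dual rE inj_th inj_phi triK triL uij vrs).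
(* For [nu = Up] the duality is applied to [E] in reversed order, with the eigenvalues permuted
   accordingly; tridiagonality survives reversal, and reversing twice restores [E]. *)
apply: (split_comp_ortho (theta := theta \o @rev_ord _) resolution_dual
  (rev_resolution rE) _ inj_phi _ _ uij _ rD sD neq).
- exact: inj_comp inj_th rev_ord_inj.
- by rewrite (reindex_inj rev_ord_inj); under eq_bigr do rewrite /= /rev_idem rev_ordK.
- by move=> h k hk; apply: triL; move: hk (ltn_ord h) (ltn_ord k) => /=; lia.
- by rewrite (eq_split_comp _ _ (frefl _) (rev_idemK E)).
Qed.

End Graph.

Theorem theorem1p1 (R : realType) (X : finType) (e : rel X)
    (E : 'I_(diameter e).+1 -> 'M[R[i]]_#|X|) (x : X) :
  connected_simple_graph e ->
  distance_regular e ->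
  (3 <= diameter e)%N ->
  primitive_idempotents E ->
  Q_polynomial E ->
  forall i j r s : 'I_(diameter e).+1,
    (~ ((i + r)%N = diameter e /\ (j + s)%N = diameter e) ->
      forall u v : 'cV[R[i]]_#|X|,
        u \in split_component E x Down Down i j ->
        v \in split_component E x Up Up r s ->
        hform u v = 0)
    /\
    (~ ((i + r)%N = diameter e /\ (j + s)%N = diameter e) ->
      forall u v : 'cV[R[i]]_#|X|,
        u \in split_component E x Down Up i j ->
        v \in split_component E x Up Down r s ->
        hform u v = 0).
Proof.
move=> sgraph _ D3 prim Qpoly i j r s.
have D0 : (0 < diameter e)%N by apply: leq_trans D3.
split=> neq u v uij vrs.
  exact: (split_components_ortho (nu := Down) sgraph prim Qpoly D0 neq uij vrs).
exact: (split_components_ortho (nu := Up) sgraph prim Qpoly D0 neq uij vrs).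
Qed.
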